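(* Let $q : \mathbb{R}^n \to \mathbb{R}$ be a positive semidefinite quadratic form such that $\mathbf{E}(q) = 1$, where $\mathbf{E}$ denotes expectation with respect to the standard Gaussian measure $\mu$ on $\mathbb{R}^n$. Let $$C_0 = \frac{4}{\sqrt{2\pi}} \int_0^{+\infty} (\ln t)\, e^{-t^2/2}\, dt \approx -1.270362845.$$ Then $$C_0 \leq \mathbf{E}(\ln q) \leq 0 \qquad\text{and}\qquad 0 \leq \mathbf{E}(\ln^2 q) \leq 8.$$
   Context: The standard Gaussian measure $\mu$ on $\mathbb{R}^n$ has density $\psi(x) = (2\pi)^{-n/2}\exp\{-\|x\|^2/2\}$, with $\|x\|^2 = x_1^2+\dots+x_n^2$. For a $\mu$-integrable function $f$, $\mathbf{E}(f) = \int_{\mathbb{R}^n} f(x)\psi(x)\,dx$. *)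

(* Defs.v *)
From HB Require Import structures.
From mathcomp Require Import all_boot all_order all_algebra.
From mathcomp Require Import all_classical all_reals all_analysis.
Set Implicit Arguments. Unset Strict Implicit. Unset Printing Implicit Defensive.
Import Order.TTheory GRing.Theory Num.Theory.
Import numFieldNormedType.Exports.
Local Open Scope classical_set_scope.
Local Open Scope ring_scope.

Definition gauss_density (R : realType) (x : R) : R :=
  expR (- (x ^+ 2) / 2) / Num.sqrt (2 * pi).

Definition gauss1 (R : realType) (A : set R) : \bar R :=
  (\int[@lebesgue_measure R]_(x in A) (gauss_density x)%:E)%E.

Definition box (R : realType) (n : nat) (A : 'I_n -> set R) : set (n.-tuple R) :=
  [set x | forall i, A i (tnth x i)].

(* mu is the standard Gaussian measure on R^n: the product of n copies of the
   one-dimensional standard Gaussian measure (characterised on measurable boxes;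
   by the pi-lambda theorem this determines mu uniquely). *)
Definition is_std_gaussian (R : realType) (n : nat)
    (mu : {measure set (n.-tuple R) -> \bar R}) : Prop :=
  forall A : 'I_n -> set R, (forall i, measurable (A i)) ->
    mu (box A) = (\prod_(i < n) gauss1 (A i))%E.

Definition quadform (R : realType) (n : nat) (a : 'M[R]_n) (x : n.-tuple R) : R :=
  \sum_(i < n) \sum_(j < n) a i j * tnth x i * tnth x j.

Definition C0 (R : realType) : \bar R :=
  ((4 / Num.sqrt (2 * pi) : R)%:E *
   \int[@lebesgue_measure R]_(t in `]0%R, +oo[%classic) (ln t * expR (- (t ^+ 2) / 2))%:E)%E.

(* Main.v *)
(* Completing squares along the coordinate axes writes a positive semidefinite
   form as q = sum_k l_k <u_k, x>^2 with l_k >= 0 and unit vectors u_k that need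
   not be orthogonal; each <u_k, x> is then a standard normal variable, because
   sums of independent normals are normal. Hence E q = sum_k l_k = 1, and q is
   pointwise a convex combination of the w_k = <u_k, x>^2. Concavity of ln gives
   ln q >= sum_k l_k ln w_k, whose expectation is C0 = E (ln z^2) for z ~ N(0, 1),
   and ln q <= q - 1 gives the upper bound. For the second moment,
   ln^2 q <= ln^2 (min (q, 1)) + q and t |-> ln^2 (min (t, 1)) is convex, so that
   E (ln^2 q) <= E (ln^2 (min (z^2, 1))) + 1, where the expectation on the right
   is at most (16 / sqrt (2 pi)) <= 7 because ln^2 has integral 2 over ]0, 1]. *)
Require Import Defs.
From HB Require Import structures.
From mathcomp Require Import all_boot all_order all_algebra.
From mathcomp Require Import all_classical all_reals all_analysis.
From mathcomp Require Import measurable_realfun ring lra.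
Import Order.TTheory GRing.Theory Num.Theory.
Import numFieldNormedType.Exports.
Local Open Scope classical_set_scope.
Local Open Scope ring_scope.
Set Implicit Arguments.
Unset Strict Implicit.
Unset Printing Implicit Defensive.

(** * Sums of squares *)

Section sum_of_squares.
Context {R : rcfType} {n : nat}.
Implicit Types (b : 'M[R]_n) (x u : 'rV[R]_n) (k : 'I_n).

Local Notation delta k := (@delta_mx R 1 n 0 k).

Let form b x : R := (x *m b *m x^T) 0 0.

Let symE b i j : b^T = b -> b i j = b j i.
Proof. by move=> sb; rewrite -[b in LHS]sb mxE. Qed.

Let form_shift b x k (t : R) : b^T = b ->
  form b (x + t *: delta k) =
  form b x + 2 * t * (x *m b) 0 k + t ^+ 2 * b k k.
Proof.
move=> sb.
have E1 : (x *m b *m (delta k)^T) 0 0 = (x *m b) 0 k.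
  by rewrite trmx_delta -colE mxE.
have E2 : (delta k *m b *m x^T) 0 0 = (x *m b) 0 k.
  rewrite -mulmxA -rowE !mxE; apply: eq_bigr => i _.
  by rewrite !mxE (symE k i sb) mulrC.
have E3 : (delta k *m b *m (delta k)^T) 0 0 = b k k.
  by rewrite -rowE trmx_delta -colE !mxE.
rewrite /form linearD linearZ/= !mulmxDl !mulmxDr -!scalemxAl -!scalemxAr.
move: (x *m b *m (delta k)^T) (delta k *m b *m x^T) E1 E2 => p q E1 E2.
move: (delta k *m b *m (delta k)^T) (x *m b *m x^T) E3 => r s E3.
have entryD (A B : 'M[R]_1) : (A + B) 0 0 = A 0 0 + B 0 0 by rewrite mxE.
have entryZ c (A : 'M[R]_1) : (c *: A) 0 0 = c * A 0 0 by rewrite mxE.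
by rewrite !(entryD, entryZ) E1 E2 E3; ring.
Qed.

(* Completing the square along [e_k] kills row [k]; when [b k k = 0] the
   division by zero makes the step void, row [k] being already null. *)
Let step b k := b - (b k k)^-1 *: (col k b *m row k b).

Let stepE b k i j : step b k i j = b i j - b i k * b k j / b k k.
Proof. by rewrite !mxE big_ord1 !mxE mulrC. Qed.

Let form_step b k x : b^T = b ->
  form (step b k) x = form b x - (x *m b) 0 k ^+ 2 / b k k.
Proof.
move=> sb.
have E : (row k b *m x^T) 0 0 = (x *m b) 0 k.
  rewrite !mxE; apply: eq_bigr => i _.
  by rewrite !mxE (symE k i sb) mulrC.
rewrite /form /step mulmxBr mulmxBl -scalemxAr -scalemxAl.
rewrite mulmxA -(mulmxA (x *m col k b)).
have E' : (x *m col k b) 0 0 = (x *m b) 0 k.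
  by rewrite !mxE; apply: eq_bigr => i _; rewrite !mxE.
move: (x *m b *m x^T) (x *m col k b) (row k b *m x^T) ((x *m b) 0 k) E E'.
move=> p q r c E E'.
rewrite !mxE big_ord1 E E'.  by congr (_ - _); rewrite mulrC -expr2.
Qed.

Let step_sym b k : b^T = b -> (step b k)^T = step b k.
Proof.
move=> sb; apply/matrixP => i j; rewrite mxE !stepE.
by rewrite (symE j i sb) (symE j k sb) (symE k i sb) (mulrC (b i k)).
Qed.

(** With [b k k = 0] the form is affine in [t] along [delta i + t *: delta k], with slope
    [2 * b i k]; a nonzero slope would let it go negative. The [t] chosen in the proof gives it the
    value -1. *)
Let form_null b k : b^T = b -> (forall x, 0 <= form b x) -> b k k = 0 ->
  forall i, b i k = 0.
Proof.
move=> sb b0 bkk i; apply/eqP/negPn/negP => bik.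
pose t := - (form b (delta i) + 1) / (2 * b i k).
have := b0 (delta i + t *: delta k).
rewrite form_shift// bkk mulr0 addr0 -rowE mxE.
have -> : 2 * t * b i k = - (form b (delta i) + 1) by rewrite /t; field.
by lra.
Qed.

Let form_step_ge0 b k : b^T = b -> (forall x, 0 <= form b x) ->
  forall x, 0 <= form (step b k) x.
Proof.
move=> sb b0 x; rewrite form_step//.
have [bkk|bkk] := eqVneq (b k k) 0; first by rewrite bkk invr0 mulr0 subr0.
(* This translate minimises the form on the line through [x] directed by [delta k], and the minimum
   is the value of the reduced form at [x]. *)
have := b0 (x + (- (x *m b) 0 k / b k k) *: delta k).
rewrite form_shift//; congr (_ <= _); by field.
Qed.

Let step_row b k : b^T = b -> (forall x, 0 <= form b x) ->
  forall j, step b k k j = 0.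
Proof.
move=> sb b0 j; rewrite stepE.
have [bkk|bkk] := eqVneq (b k k) 0; last by field.
by rewrite (symE k j sb) (form_null sb b0 bkk) bkk !mul0r subr0.
Qed.

Let diag_ge0 b k : (forall x, 0 <= form b x) -> 0 <= b k k.
Proof.
by move=> /(_ (delta k)); rewrite /form -rowE trmx_delta -colE !mxE.
Qed.

Let good (s : seq (R * 'rV[R]_n)) :=
  forall p, p \in s -> 0 <= p.1 /\ \sum_i p.2 0 i ^+ 2 = 1.

(** The subtracted term is the square of the linear form given by column [k]. Dividing that column
    by its norm makes the vector unit, and the squared norm [S] moves into the weight. *)
Let step_term b k : b^T = b -> (forall x, 0 <= form b x) ->
  exists2 s, good s & forall x, (x *m b) 0 k ^+ 2 / b k k =
    \sum_(p <- s) p.1 * (\sum_i p.2 0 i * x 0 i) ^+ 2.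
Proof.
move=> sb b0; have [bkk|bkk] := eqVneq (b k k) 0.
  by exists [::] => // x; rewrite big_nil bkk invr0 mulr0.
pose S := \sum_i b i k ^+ 2.
have S0 : 0 < S.
  rewrite /S (bigD1 k)//= ltr_wpDr ?exprn_even_gt0//.
  by apply: sumr_ge0 => i _; rewrite sqr_ge0.
have sS0 : 0 < Num.sqrt S by rewrite sqrtr_gt0.
have sqS : Num.sqrt S ^+ 2 = S by rewrite sqr_sqrtr// ltW.
exists [:: (S / b k k, \row_i (b i k / Num.sqrt S))].
  move=> p; rewrite inE => /eqP -> /=; split.
    by rewrite divr_ge0 ?(ltW S0)// diag_ge0.
  under eq_bigr do rewrite mxE expr_div_n sqS.
  by rewrite -mulr_suml divff ?gt_eqF.
move=> x; rewrite big_seq1/=.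
have -> : \sum_i (\row_j (b j k / Num.sqrt S)) 0 i * x 0 i =
    (x *m b) 0 k / Num.sqrt S.
  by rewrite mxE mulr_suml; apply: eq_bigr => i _; rewrite mxE mulrC mulrA.
by rewrite expr_div_n sqS; field; rewrite bkk gt_eqF.
Qed.

(** Induction on the number [m] of rows that may still be nonzero. Each step clears the first of
    them, [k = n - m.+1], and leaves the earlier rows null because their entries in column [k] are
    0. *)
Let sum_of_squares_sym (m : nat) b : (m <= n)%N -> b^T = b ->
  (forall x, 0 <= form b x) ->
  (forall i j : 'I_n, (i < n - m)%N -> b i j = 0) ->
  exists2 s, good s & forall x, form b x =
    \sum_(p <- s) p.1 * (\sum_i p.2 0 i * x 0 i) ^+ 2.
Proof.
elim: m b => [|m IH] b mn sb b0 bm.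
  exists [::] => // x; rewrite big_nil /form.
  have -> : b = 0 by apply/matrixP => i j; rewrite bm ?mxE// subn0.
  by rewrite mulmx0 mul0mx mxE.
have kn : (n - m.+1 < n)%N by rewrite ltn_subrL (leq_ltn_trans _ mn).
pose k := Ordinal kn.
have [s1 gs1 Es1] := step_term k sb b0.
have [] := IH (step b k) (ltnW mn) (step_sym k sb) (form_step_ge0 k sb b0).
  move=> i j; rewrite -subnSK// ltnS => ik.
  move: ik; rewrite leq_eqVlt => /orP[/eqP ik|ik].
    by rewrite (_ : i = k) ?step_row//; exact/val_inj.
  by rewrite stepE (bm i j)// (bm i k)// !mul0r subr0.
move=> s2 gs2 Es2; exists (s1 ++ s2).
  by move=> p; rewrite mem_cat => /orP[/gs1|/gs2].
by move=> x; rewrite big_cat/= -Es1 -Es2 form_step// addrC subrK.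
Qed.

Lemma psd_sum_of_squares (a : 'M[R]_n) :
  (forall x : 'rV[R]_n, 0 <= \sum_i \sum_j a i j * x 0 i * x 0 j) ->
  exists m (l : 'I_m -> R) (u : 'I_m -> 'I_n -> R),
    [/\ forall k : 'I_m, 0 <= l k, forall k : 'I_m, \sum_i u k i ^+ 2 = 1 &
    forall x : 'I_n -> R, \sum_i \sum_j a i j * x i * x j =
      \sum_(k < m) l k * (\sum_i u k i * x i) ^+ 2].
Proof.
(* [a] may fail to be symmetric; its symmetric part gives the same form. *)
pose b := 2^-1 *: (a + a^T).
have formE x : form b x = \sum_i \sum_j a i j * x 0 i * x 0 j.
  have -> : form b x = \sum_i \sum_j b i j * x 0 i * x 0 j.
    rewrite /form mxE exchange_big/=; apply: eq_bigr => i _.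
    rewrite !mxE mulr_suml; apply: eq_bigr => j _.
    by rewrite -mulrA mulrCA mulrA.
  transitivity (2^-1 * (\sum_i \sum_j a i j * x 0 i * x 0 j +
      \sum_i \sum_j a j i * x 0 i * x 0 j)).
    rewrite -big_split/= mulr_sumr; apply: eq_bigr => i _.
    rewrite -big_split/= mulr_sumr; apply: eq_bigr => j _.
    by rewrite !mxE; ring.
  rewrite [X in _ + X]exchange_big/=.
  under [X in _ + X]eq_bigr do under eq_bigr do rewrite mulrAC.
  by field.
move=> a0.
have sb : b^T = b by rewrite linearZ/= linearD/= trmxK addrC.
have [|i j|s gs Es] := sum_of_squares_sym (leqnn n) sb.
- by move=> x; rewrite formE.
- by rewrite subnn.
exists (size s), (fun k : 'I_(size s) => (tnth (in_tuple s) k).1),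
  (fun (k : 'I_(size s)) i => (tnth (in_tuple s) k).2 0 i); split.
- by move=> k; have [] := gs _ (mem_tnth k (in_tuple s)).
- by move=> k; have [] := gs _ (mem_tnth k (in_tuple s)).
move=> x; have := formE (\row_i x i).
under eq_bigr do under eq_bigr do rewrite !mxE.
move=> <-; rewrite Es big_tnth; apply: eq_bigr => k _.
by congr (_ * _ ^+ 2); apply: eq_bigr => i _; rewrite mxE.
Qed.

End sum_of_squares.

(** * Affine maps and Lebesgue measure *)

Section affine.
Context {R : realType}.
Local Notation lambda := (@lebesgue_measure R).
Local Notation aff c b := (fun t : R => (c * t + b)%R).

Lemma measurable_affine (c b : R) :
  measurable_fun [set: R] (aff c b).
Proof. by apply: measurable_funD => //; exact: measurable_funM. Qed.

Let lebesgue_measure_affine_itv (c b x y : R) : c != 0 ->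
  (`|c|%:E * lambda (aff c b @^-1` `]x, y]) = lambda `]x, y])%E.
Proof.
move=> c0; have [cp|cn] := ltP 0 c.
  have -> : aff c b @^-1` `]x, y] = `](x - b) / c, (y - b) / c]%classic.
    apply/seteqP; split => t /=; rewrite !in_itv/= ltr_pdivrMr// ler_pdivlMr//;
    by rewrite ltrBlDr lerBrDr (mulrC t).
  rewrite !lebesgue_measure_itv/= !lte_fin ltr_pM2r ?invr_gt0// ltrD2r.
  case: ifP => _; last by rewrite mule0.
  by rewrite -!EFinD -EFinM gtr0_norm//; congr EFin; field.
have {}cn : c < 0 by rewrite lt_neqAle c0.
have -> : aff c b @^-1` `]x, y] = `[(y - b) / c, (x - b) / c[%classic.
  apply/seteqP; split => t /=; rewrite !in_itv/= ler_ndivrMr// ltr_ndivlMr//;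
  by rewrite ltrBlDr lerBrDr (mulrC t) andbC.
rewrite !lebesgue_measure_itv/= !lte_fin ltr_nM2r ?invr_lt0// ltrD2r.
case: ifP => _; last by rewrite mule0.
by rewrite -!EFinD -EFinM ltr0_norm//; congr EFin; field.
Qed.

(** The image of Lebesgue measure under the affine map, scaled by [|c|], gives half-open intervals
    their length, and this characterises Lebesgue measure. *)
Lemma lebesgue_measure_affine (c b : R) (A : set R) : c != 0 -> measurable A ->
  (`|c|%:E * lambda (aff c b @^-1` A) = lambda A)%E.
Proof.
move=> c0 mA.
have mf : @measurable_fun _ _ (measurableTypeR R) (measurableTypeR R) setT
  (aff c b) := measurable_affine c b.
pose nu0 : {measure set (measurableTypeR R) -> \bar R} :=
  measure_function_pushforward__canonical__measure_function_Measure lambda mf.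
pose nu : {measure set (measurableTypeR R) -> \bar R} :=
  [the measure _ _ of mscale (NngNum (normr_ge0 c)) nu0].
apply/esym/(@lebesgue_measure_unique R nu) => // _ [[x y]] _ <-.
by rewrite /nu/= /mscale/= /pushforward lebesgue_measure_affine_itv.
Qed.

Lemma ge0_integral_affine (c b : R) (f : R -> \bar R) : c != 0 ->
  measurable_fun setT f -> (forall x, (0 <= f x)%E) ->
  (\int[lambda]_x f x = `|c|%:E * \int[lambda]_x f (c * x + b)%R)%E.
Proof.
move=> c0 mf f0.
have ma : @measurable_fun _ _ (measurableTypeR R) (measurableTypeR R) setT
  (aff c b) := measurable_affine c b.
pose nu0 : {measure set (measurableTypeR R) -> \bar R} :=
  measure_function_pushforward__canonical__measure_function_Measure lambda ma.
pose nu : {measure set (measurableTypeR R) -> \bar R} :=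
  [the measure _ _ of mscale (NngNum (normr_ge0 c)) nu0].
transitivity (\int[nu]_x f x)%E.
  apply: eq_measure_integral => A mA _.
  exact/esym/lebesgue_measure_affine.
rewrite /nu ge0_integral_mscale//; congr (_ * _)%E.
by rewrite ge0_integral_pushforward.
Qed.

End affine.

(** * Convolution of normal laws *)

Section normal_law.
Context {R : realType}.
Local Notation lambda := (@lebesgue_measure R).
Local Notation aff c b := (fun t : R => (c * t + b)%R).
Local Notation normal := (@normal_prob R).

(** The Radon-Nikodym derivative and [normal_pdf] have the same integral over every measurable set,
    hence agree almost everywhere. *)
Lemma ge0_integral_normal_prob (m s : R) (f : R -> \bar R) :
  measurable_fun setT f -> (forall x, (0 <= f x)%E) ->
  (\int[normal m s]_x f x = \int[lambda]_x (f x * (normal_pdf m s x)%:E))%E.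
Proof.
move=> mf f0; have dom := normal_prob_dominates m s.
rewrite -(Radon_Nikodym_SigmaFinite.change_of_variables dom)//.
have iRN := Radon_Nikodym_SigmaFinite.f_integrable dom.
have mpdf : measurable_fun setT (fun x => (normal_pdf m s x)%:E).
  by apply/measurable_EFinP; exact: measurable_normal_pdf.
apply: ae_eq_integral => //.
- by apply: emeasurable_funM => //; exact: measurable_int iRN.
- exact: emeasurable_funM.
apply: ae_eqe_mul2l; apply: integral_ae_eq => //.
by move=> E _ mE; rewrite -Radon_Nikodym_SigmaFinite.f_integral.
Qed.

Lemma normal_pdf_ge0E (m s x : R) : (0 <= (normal_pdf m s x)%:E)%E.
Proof. by rewrite lee_fin normal_pdf_ge0. Qed.

Lemma normal_probE (m s : R) (B : set R) : measurable B ->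
  (normal m s B = \int[lambda]_x ((\1_B x)%:E * (normal_pdf m s x)%:E))%E.
Proof.
move=> mB; rewrite /normal_prob integral_mkcond; apply: eq_integral => x _.
rewrite patchE indicE; case: (x \in B); [by rewrite mul1e|by rewrite mul0e].
Qed.

Lemma normal_pdf_affine (c b x : R) : c != 0 ->
  `|c| * normal_pdf b c (c * x + b) = normal_pdf 0 1 x.
Proof.
move=> c0; rewrite !normal_pdfE ?oner_neq0// /normal_peak /normal_fun.
rewrite expr1n mul1r addrK subr0 mulrA; congr (_ * expR _); last first.
  by rewrite exprMn; field.
rewrite -mulrnAr sqrtrM ?sqr_ge0// sqrtr_sqr invfM mulrA.
by rewrite divff ?mul1r ?normr_eq0.
Qed.

Lemma normal_prob_affine (c b : R) (B : set R) : c != 0 -> measurable B ->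
  normal 0 1 (aff c b @^-1` B) = normal b c B.
Proof.
move=> c0 mB; have mf : measurable_fun setT (aff c b) := measurable_affine c b.
have mB' : measurable (aff c b @^-1` B).
  by rewrite -[X in measurable X]setTI; exact: mf.
have mpdf m s : measurable_fun setT (fun x : R => (normal_pdf m s x)%:E).
  by apply/measurable_EFinP; exact: measurable_normal_pdf.
rewrite (normal_probE 0 1 mB') (normal_probE b c mB).
rewrite [RHS](ge0_integral_affine b c0); last 2 first.
- by apply: emeasurable_funM => //; apply/measurable_EFinP.
- by move=> x; rewrite mule_ge0 ?normal_pdf_ge0E ?lee_fin.
rewrite -ge0_integralZl_EFin//; last 2 first.
- by move=> x _; rewrite mule_ge0 ?normal_pdf_ge0E ?lee_fin.
- apply: (measurableT_comp
    (f := fun x => (\1_B x)%:E * (normal_pdf b c x)%:E)%E) => //.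
  by apply: emeasurable_funM => //; apply/measurable_EFinP.
by apply: eq_integral => x _; rewrite -(normal_pdf_affine b x c0) EFinM muleCA.
Qed.

(** The density involves the deviation only through its square, so no sign convention on deviations
    is required. *)
Lemma normal_prob_sqr (s t : R) (B : set R) : s != 0 -> s ^+ 2 = t ^+ 2 ->
  normal 0 s B = normal 0 t B.
Proof.
move=> s0 st; have t0 : t != 0 by rewrite -sqrf_eq0 -st sqrf_eq0.
apply: eq_integral => x _.
by rewrite !normal_pdfE// /normal_peak /normal_fun st.
Qed.

(* [N(s x, c) (z) * N(0, 1) (x)] is, up to completing the square, the density of
   [z ~ N(0, t)] times that of [x] given [z]. *)
Lemma normal_pdf_convolution (c s t x z : R) :
  c != 0 -> t != 0 -> t ^+ 2 = c ^+ 2 + s ^+ 2 ->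
  normal_pdf (s * x) c z * normal_pdf 0 1 x =
  normal_pdf 0 t z * normal_pdf (s * z / t ^+ 2) (c / t) x.
Proof.
move=> c0 t0 tE; have ct0 : c / t != 0 by rewrite mulf_neq0 ?invr_eq0.
rewrite !normal_pdfE ?oner_neq0// /normal_peak /normal_fun.
rewrite mulrACA [RHS]mulrACA -!expRD; congr (_ * expR _); last first.
  have T0 : c ^+ 2 + s ^+ 2 != 0 by rewrite -tE sqrf_eq0.
  by rewrite expr1n !expr_div_n tE; field; rewrite T0 c0.
have nn (u : R) : 0 <= u ^+ 2 * pi *+ 2.
  by rewrite mulrn_wge0// mulr_ge0 ?sqr_ge0 ?pi_ge0.
rewrite -!invfM -!sqrtrM ?nn//.
by congr (Num.sqrt _)^-1; field.
Qed.

Lemma normal_prob_setT (m s : R) : normal m s setT = 1%E.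
Proof. exact: integral_normal_pdf. Qed.

(** Each value is the mass of the section at [x] of one measurable subset of the plane. *)
Lemma measurable_normal_affine (c s : R) (B : set R) : measurable B ->
  measurable_fun setT (fun x : R => normal 0 1 (aff c (s * x) @^-1` B)).
Proof.
move=> mB; pose E := [set p : R * R | B (c * p.2 + s * p.1)].
have mE : measurable E.
  rewrite -[X in measurable X]setTI.
  have : measurable_fun setT (fun p : R * R => c * p.2 + s * p.1).
    by apply: measurable_funD; apply: measurable_funM.
  exact.
have := @measurable_fun_xsection _ _ _ _ _ (normal 0 1) _ mE.
apply: eq_measurable_fun => x _; congr (normal 0 1 _).
by apply/seteqP; split => y /=; rewrite /xsection /= inE.
Qed.

(** Laws are written as images of N(0, 1) under scaling, so that deviation 0 means the Dirac mass at
    0. If [s = 0] the integrand is constant; if [c = 0] it is an indicator. Otherwise Tonelli swaps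
    the integrals, and by [normal_pdf_convolution] the inner one becomes that of a conditional
    density, equal to 1. *)
Lemma normal_prob_convolution (c s t : R) (B : set R) :
  t ^+ 2 = c ^+ 2 + s ^+ 2 -> measurable B ->
  (\int[normal 0 1]_x normal 0 1 (aff c (s * x) @^-1` B) =
   normal 0 1 (aff t 0 @^-1` B))%E.
Proof.
move=> tE mB; have [s0|s0] := eqVneq s 0.
  rewrite s0 expr0n addr0 in tE.
  rewrite (eq_integral (fun=> normal 0 1 (aff c 0 @^-1` B))); last first.
    by move=> x _; rewrite s0 mul0r.
  transitivity (normal 0 1 (aff c 0 @^-1` B)).
    by rewrite integral_cst// [X in (_ * X)%E](normal_prob_setT 0 1) mule1.
  have [c0|c0] := eqVneq c 0.
    by have /eqP := tE; rewrite c0 expr0n/= sqrf_eq0 => /eqP ->.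
  have t0 : t != 0 by rewrite -sqrf_eq0 tE sqrf_eq0.
  rewrite (normal_prob_affine 0 c0 mB) (normal_prob_affine 0 t0 mB).
  exact: normal_prob_sqr.
have t0 : t != 0.
  by rewrite -sqrf_eq0 tE paddr_eq0 ?sqr_ge0// !sqrf_eq0 negb_and s0 orbT.
have [c0|c0] := eqVneq c 0.
  rewrite c0 expr0n add0r in tE.
  transitivity (\int[normal 0 1]_x (\1_(aff s 0 @^-1` B) x)%:E)%E.
    apply: eq_integral => x _; rewrite indicE.
    have [xB|xB] := boolP (x \in _).
      rewrite (_ : _ @^-1` _ = setT) ?normal_prob_setT//.
      apply/seteqP; split => // y _ /=; move: xB.
      by rewrite inE/= addr0 c0 mul0r add0r.
    rewrite (_ : _ @^-1` _ = set0) ?measure0//.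
    apply/seteqP; split => // y /=; move: xB.
    by rewrite notin_setE/= addr0 c0 mul0r add0r.
  have mB' : measurable (aff s 0 @^-1` B).
    by rewrite -[X in measurable X]setTI; exact: measurable_affine.
  transitivity (normal 0 1 (aff s 0 @^-1` B)).
    by rewrite integral_indic// setIT.
  rewrite (normal_prob_affine 0 s0 mB) (normal_prob_affine 0 t0 mB).
  exact: normal_prob_sqr.
have mpdf m v : measurable_fun setT (normal_pdf m v : R -> R).
  exact: measurable_normal_pdf.
rewrite (normal_prob_affine 0 t0 mB).
pose k (x z : R) : \bar R :=
  ((\1_B z)%:E * (normal_pdf (s * x) c z * normal_pdf 0 1 x)%:E)%E.
transitivity (\int[lambda]_x \int[lambda]_z k x z)%E.
  transitivity (\int[lambda]_x (normal (s * x) c B * (normal_pdf 0 1 x)%:E))%E.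
    rewrite (ge0_integral_normal_prob 0 1 (measurable_normal_affine c s mB)).
      by apply: eq_integral => x _; rewrite (normal_prob_affine _ c0 mB).
    by move=> x; exact: measure_ge0.
  apply: eq_integral => x _; rewrite (normal_probE _ _ mB) -ge0_integralZr//.
  - by apply: eq_integral => z _; rewrite /k EFinM muleA.
  - by apply: emeasurable_funM; apply/measurable_EFinP;
      [exact: measurable_indic|exact: mpdf].
  - by move=> z _; rewrite mule_ge0 ?normal_pdf_ge0E ?lee_fin.
  - exact: normal_pdf_ge0E.
rewrite (@fubini_tonelli _ _ _ _ _ lambda lambda (fun p => k p.1 p.2))/=;
  last 2 first.
- apply: emeasurable_funM; apply/measurable_EFinP.
    by apply: measurableT_comp => //; exact: measurable_indic.
  apply: measurable_funM.
    apply: (eq_measurable_fun (fun p : R * R =>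
        normal_peak c * normal_fun (s * p.1) c p.2)).
      by move=> p _; rewrite normal_pdfE.
    apply: measurable_funM => //.
    apply: measurableT_comp => //; apply: measurable_funM => //.
    apply: measurableT_comp => //; apply: measurable_funX => //.
    by apply: measurable_funB => //; apply: measurable_funM.
  by apply: (measurableT_comp (mpdf _ _)).
- by move=> [x z]; rewrite /k mule_ge0 ?lee_fin// mulr_ge0// normal_pdf_ge0.
rewrite (normal_probE _ _ mB); apply: eq_integral => z _.
transitivity (\int[lambda]_x (((\1_B z)%:E * (normal_pdf 0 t z)%:E) *
    (normal_pdf (s * z / t ^+ 2) (c / t) x)%:E))%E.
  apply: eq_integral => x _.
  by rewrite /k (@normal_pdf_convolution _ _ t)// EFinM muleA.
rewrite ge0_integralZl//.
- by rewrite integral_normal_pdf mule1.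
- by apply/measurable_EFinP; exact: mpdf.
- by move=> x _; exact: normal_pdf_ge0E.
- by rewrite mule_ge0 ?normal_pdf_ge0E ?lee_fin.
Qed.

End normal_law.

(** * Linear forms of a Gaussian vector *)

Section linear_form_law.
Context {R : realType}.
Local Notation aff c b := (fun t : R => (c * t + b)%R).
Local Notation normal := (@normal_prob R).

(** Named so that it can carry the measurable-function structure that [distribution] expects. *)
Definition affine (c b : R) : measurableTypeR R -> measurableTypeR R := aff c b.

HB.instance Definition _ (c b : R) :=
  isMeasurableFun.Build _ _ _ _ (affine c b) (measurable_affine c b).

Lemma gauss1E (A : set R) : gauss1 A = normal 0 1 A.
Proof.
apply: eq_integral => x _.
rewrite normal_pdfE ?oner_neq0// /normal_peak /normal_fun /gauss_density.
by rewrite expr1n mul1r subr0 mulrC (_ : 2 * pi = pi *+ 2)//; ring.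
Qed.

Variables (n : nat) (mu : {measure set (n.-tuple R) -> \bar R}).
Hypothesis mu_gauss : is_std_gaussian mu.

Lemma std_gaussian_setT : mu setT = 1%E.
Proof.
have <- : box (fun _ : 'I_n => [set: R]) = setT by apply/seteqP; split.
rewrite mu_gauss// big1// => i _.
by rewrite gauss1E normal_prob_setT.
Qed.

Variable u : 'I_n -> R.

Lemma measurable_linear_form (P : pred 'I_n) :
  measurable_fun setT (fun x : n.-tuple R => \sum_(i | P i) u i * tnth x i).
Proof.
under eq_fun do rewrite big_mkcond/=.
apply: measurable_sum => i; case: (P i) => //; apply: measurable_funM => //.
exact: measurable_tnth.
Qed.

Let partial (k : nat) (x : n.-tuple R) : R :=
  \sum_(i < n | (i < k)%N) u i * tnth x i.

(* The coordinates [i >= k] are carried along so that the induction step finds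
   the next summand independent of the partial sum. *)
Let partial_law k t (A : 'I_n -> set R) (B : set R) : (k <= n)%N ->
  t ^+ 2 = \sum_(i < n | (i < k)%N) u i ^+ 2 ->
  (forall i, measurable (A i)) -> measurable B ->
  mu ((partial k @^-1` B) `&`
      [set x | forall i : 'I_n, (k <= i)%N -> A i (tnth x i)]) =
  (normal 0 1 (aff t 0 @^-1` B) * \prod_(i < n | (k <= i)%N) normal 0 1 (A i))%E.
Proof.
elim: k t A B => [|k IH] t A B kn tE mA mB.
  have {tE} t0 : t = 0 by apply/eqP; rewrite -sqrf_eq0 tE big_pred0.
  have partial0 x : partial 0 x = 0 by rewrite /partial big_pred0.
  (* The empty sum is 0 and so is [t]: both sides only depend on whether [B] contains 0. *)
  have [B0|B0] := pselect (B 0).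
    have -> : aff t 0 @^-1` B = setT.
      by apply/seteqP; split => // x _ /=; rewrite t0 mul0r addr0.
    have -> : partial 0 @^-1` B = setT.
      by apply/seteqP; split => // x _ /=; rewrite partial0.
    rewrite setTI normal_prob_setT mul1e.
    transitivity (mu (box A)).
      by congr (mu _); apply/seteqP; split => x /= Ax i;
        [exact: Ax|move=> _; exact: Ax].
    by rewrite mu_gauss//; apply: eq_bigr => i _; rewrite gauss1E.
  have -> : aff t 0 @^-1` B = set0.
    by apply/seteqP; split => // x /=; rewrite t0 mul0r addr0.
  have -> : partial 0 @^-1` B = set0.
    by apply/seteqP; split => // x /=; rewrite partial0.
  by rewrite set0I !measure0 mul0e.
pose k' := Ordinal kn.
pose s := Num.sqrt (\sum_(i < n | (i < k)%N) u i ^+ 2).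
have sE : s ^+ 2 = \sum_(i < n | (i < k)%N) u i ^+ 2.
  by rewrite sqr_sqrtr// sumr_ge0// => i _; rewrite sqr_ge0.
have split_sum (F : 'I_n -> R) :
    \sum_(i < n | (i < k.+1)%N) F i = \sum_(i < n | (i < k)%N) F i + F k'.
  rewrite (bigD1 k')/= ?ltnS// addrC; congr (_ + _); apply: eq_bigl => i.
  by rewrite -val_eqE/= ltnS ltn_neqAle andbC.
have tE' : t ^+ 2 = s ^+ 2 + u k' ^+ 2 by rewrite tE split_sum sE.
pose C := (\prod_(i < n | (k < i)%N) normal 0 1 (A i))%E.
have C0 : (0 <= C)%E by apply: prode_ge0.
have Cfin : C \is a fin_num.
  apply: (big_ind (fun y : \bar R => y \is a fin_num)) => //.
    by move=> y z; exact: fin_numM.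
  by move=> i _; exact: (fin_num_measure (normal 0 1) _ (mA i)).
(* The coordinates after [k] contribute the constant [C]. Scaling the law of coordinate [k] by it
   makes the joint law below exactly a product. *)
pose c : {nonneg R} := NngNum (fine_ge0 C0).
pose m1 := [the {finite_measure set (measurableTypeR R) -> \bar R} of
  mscale c (normal 0 1)].
pose m2 := [the {finite_measure set (measurableTypeR R) -> \bar R} of
  distribution (normal 0 1) (affine s 0)].
pose D := [set x : n.-tuple R | forall i : 'I_n, (k < i)%N -> A i (tnth x i)].
have mD : measurable D.
  have -> : D = \bigcap_(i in [set i : 'I_n | (k < i)%N])
      ((@tnth _ R)^~ i @^-1` A i).
    by apply/seteqP; split.
  apply: fin_bigcap_measurable => // i _.
  by rewrite -[X in measurable X]setTI; exact: measurable_tnth.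
pose phi (x : n.-tuple R) : measurableTypeR R * measurableTypeR R :=
  (tnth x k', partial k x).
have mphi : measurable_fun setT phi.
  apply: measurable_fun_pair; first exact: measurable_tnth.
  exact: measurable_linear_form.
pose mur : {measure set (n.-tuple R) -> \bar R} := [the measure _ _ of mrestr mu mD].
pose nu :=
  measure_function_pushforward__canonical__measure_function_Measure mur mphi.
(* [nu] is the joint law of coordinate [k] and the partial sum, restricted to [D]. On rectangles the
   induction hypothesis applies, with [X] as the constraint on coordinate [k]. Uniqueness of the
   product measure then extends the formula to [E], the event that the next partial sum falls in
   [B]. *)
have nuE X Y : measurable X -> measurable Y -> nu (X `*` Y) = (m1 X * m2 Y)%E.
  move=> mX mY; pose A' i := if i == k' then X else A i.
  transitivity (mu ((partial k @^-1` Y) `&`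
      [set x | forall i : 'I_n, (k <= i)%N -> A' i (tnth x i)])).
    congr (mu _); apply/seteqP; split => x.
      move=> [[/= xX xY] xA]; split => // i; rewrite leq_eqVlt.
      rewrite /A'; case: ifPn => [/eqP -> _ //|ik /predU1P[ki|]]; last exact: xA.
      by move: ik; rewrite -val_eqE/= ki eqxx.
    move=> [/= xY xA]; split; first split => //=.
      by have := xA k' (leqnn _); rewrite /A' eqxx.
    move=> i ki; have := xA i (ltnW ki).
    by rewrite /A' -val_eqE/= gtn_eqF.
  have mA' i : measurable (A' i).
    by rewrite /A'; case: ifP => _; [exact: mX|exact: mA].
  rewrite (IH s A' Y (ltnW kn) sE mA' mY) (bigD1 k')//= {1}/A' eqxx.
  have -> : (\prod_(i < n | (k <= i)%N && (i != k')) normal 0 1 (A' i))%E = C.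
    rewrite /C; apply: eq_big => i.
      by rewrite -val_eqE/= ltn_neqAle andbC eq_sym.
    by move=> /andP[_ /negbTE ik]; rewrite /A' ik.
  rewrite muleC (muleC _ C); congr (_ * _)%E.
  by rewrite -[in LHS](fineK Cfin).
pose E := [set p : R * R | B (u k' * p.1 + p.2)].
have mE : measurable E.
  rewrite -[X in measurable X]setTI.
  have : measurable_fun setT (fun p : R * R => u k' * p.1 + p.2).
    by apply: measurable_funD => //; apply: measurable_funM.
  exact.
have := product_measure_unique nuE mE.
have -> : nu E = mu (partial k.+1 @^-1` B `&`
    [set x | forall i : 'I_n, (k < i)%N -> A i (tnth x i)]).
  congr (mu _); apply/seteqP; split => x [/= xB xA]; split => //=.
    by move: xB; rewrite /partial split_sum addrC.
  by move: xB; rewrite /E/= /partial split_sum addrC.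
move=> <-.
transitivity (C * \int[normal 0 1]_x
    normal 0 1 (aff s (u k' * x)%R @^-1` B))%E; last first.
  by rewrite (normal_prob_convolution tE' mB) muleC.
have Escale := @ge0_integral_mscale _ _ R (normal 0 1) setT measurableT c _
  (measurable_normal_affine s (u k') mB) (fun x _ => measure_ge0 _ _).
rewrite -[in RHS](fineK Cfin); apply: (eq_trans _ Escale).
apply: eq_integral => x _; congr (normal 0 1 _); apply/seteqP; split => y /=;
rewrite /xsection /E/= /affine inE/= => yB.
  by move: yB; rewrite addr0 addrC.
by rewrite addr0 addrC.
Qed.

Lemma std_gaussian_linear_form (t : R) (B : set R) :
  t ^+ 2 = \sum_i u i ^+ 2 -> measurable B ->
  mu ((fun x => \sum_i u i * tnth x i) @^-1` B) = normal 0 1 (aff t 0 @^-1` B).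
Proof.
move=> tE mB.
have tE' : t ^+ 2 = \sum_(i < n | (i < n)%N) u i ^+ 2.
  by rewrite tE; apply: eq_bigl => i; rewrite ltn_ord.
have := partial_law (leqnn n) tE' (fun=> measurableT) mB.
rewrite big_pred0 ?mule1; last by move=> i; rewrite leqNgt ltn_ord.
move=> <-; have partialE x : partial n x = \sum_i u i * tnth x i.
  by apply: eq_bigl => i; rewrite ltn_ord.
congr (mu _); apply/seteqP; split => x /=; rewrite partialE; last by case.
by move=> xB; split.
Qed.

End linear_form_law.

(** * One-dimensional integrals *)

Section calculus.
Context {R : realType}.
Local Notation lambda := (@lebesgue_measure R).

Lemma integral_is_derive (F f : R -> R) (a b : R) : a < b ->
  (forall x, a <= x <= b -> is_derive x 1 F (f x)) ->
  (forall x, a <= x <= b -> {for x, continuous f}) ->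
  (\int[lambda]_(x in `[a, b]) (f x)%:E = (F b - F a)%:E)%E.
Proof.
move=> ab dF cf; have cF x : a <= x <= b -> {for x, continuous F}.
  move=> xab; apply/differentiable_continuous/derivable1_diffP.
  by have [] := dF x xab.
rewrite EFinB; apply: continuous_FTC2 => //.
- apply: continuous_in_subspaceT => x; rewrite inE/= in_itv/=; exact: cf.
- split.
  + by move=> x /[!in_itv]/= /andP[ax xb]; have [] := dF x; rewrite ?(ltW ax) ?ltW.
  + by apply: cvg_at_right_filter; apply: cF; rewrite lexx ltW.
  + by apply: cvg_at_left_filter; apply: cF; rewrite lexx ltW.
- move=> x /[!in_itv]/= /andP[ax xb]; rewrite derive1E.
  by have [] := dF x; rewrite ?(ltW ax) ?ltW.
Qed.

(** From [sin x <= x] at [pi / 4], where the square of the sine is 1/2, [pi] is at least 2 sqrt 2,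
    about 2.83. *)
Lemma pi_gt27 : 27 / 10 < pi :> R.
Proof.
have sin_le (x : R) : 0 < x -> sin x <= x.
  move=> x0; have [c _] := @MVT R sin cos 0 x x0 (fun y _ => is_derive_sin y)
    (continuous_subspaceT (@continuous_sin R)).
  by rewrite sin0 !subr0 => ->; rewrite ler_piMl ?cos_le1// ltW.
have p0 : 0 < pi / 4 :> R by rewrite divr_gt0 ?pi_gt0.
have s0 : 0 <= sin (pi / 4 : R).
  by rewrite sin_ge0_pi// ltW//= ler_pdivrMr// ler_peMr ?pi_ge0// ler1n.
have : sin (pi / 4 : R) ^+ 2 = 2^-1.
  have := cos_pihalf R; have -> : pi / 2 = pi / 4 *+ 2 :> R by field.
  rewrite cosD -!expr2; have := cos2Dsin2 (pi / 4 : R); lra.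
have := sin_le _ p0; move: p0 s0; set s := sin _; set p := pi / 4.
move=> p0 s0 sp s2.
have -> : pi = 4 * p :> R by rewrite /p; field.
rewrite ltNge; apply/negP => p27.
have : s ^+ 2 <= (27 / 40) ^+ 2 by rewrite lerXn2r ?nnegrE//; lra.
by rewrite s2; lra.
Qed.

Lemma integral_sqr_ln01 :
  (\int[lambda]_(t in `]0%R, 1%R]) (ln t ^+ 2)%:E <= 2%:E)%E.
Proof.
pose F (t : R) := t * (ln t ^+ 2 - 2 * ln t + 2).
have dF (t : R) : 0 < t -> is_derive t 1 F (ln t ^+ 2).
  move=> t0; have dln := is_derive1_ln t0.
  by apply: is_derive_eq; rewrite /GRing.scale/=; field; rewrite gt_eqF.
(* [n.+2] keeps the left endpoint strictly below 1 from [n = 0] on. *)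
pose e (n : nat) : R := n.+2%:R^-1.
have part n : (\int[lambda]_(t in `[e n, 1%R]) (ln t ^+ 2)%:E <= 2%:E)%E.
  have e0 : 0 < e n by rewrite invr_gt0.
  have e1 : e n < 1 by rewrite invf_lt1// ltr1n.
  have gt0 x : e n <= x <= 1 -> 0 < x by case/andP => + _; exact: lt_le_trans.
  rewrite (integral_is_derive e1 (fun x ex => dF x (gt0 x ex))).
    rewrite lee_fin /F ln1 expr0n/= mulr0 subr0 add0r mul1r.
    rewrite lerBlDr lerDl mulr_ge0 ?(ltW e0)//.
    by have := sqr_ge0 (ln (e n) - 1); lra.
  move=> x /gt0 x0.
  exact: (cvg_comp _ _ (continuous_ln x0) (@exprn_continuous R 2 (ln x))).
have -> : `]0%R, 1%R]%classic = \bigcup_n `[e n, 1%R]%classic.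
  apply/seteqP; split => x /=.
    rewrite in_itv/= => /andP[x0 x1].
    have [n nx] : exists n : nat, x^-1 <= n%:R.
      by exists (Num.truncn x^-1).+1; rewrite ltW// truncnS_gt.
    exists n => //=; rewrite in_itv/= x1 andbT /e invf_ple ?posrE//.
    by rewrite (le_trans nx)// ler_nat (leq_trans (leqnSn _)).
  move=> [n _] /=; rewrite !in_itv/= => /andP[nx ->]; rewrite andbT.
  by rewrite (lt_le_trans _ nx)// invr_gt0.
have cv : (\int[lambda]_(t in `[e n, 1%R]) (ln t ^+ 2)%:E @[n --> \oo] -->
    \int[lambda]_(t in \bigcup_n `[e n, 1%R]%classic) (ln t ^+ 2)%:E)%E.
  apply: ge0_nondecreasing_set_cvg_integral => //.
  - move=> m n mn; apply/subsetPset => x /=; rewrite !in_itv/= => /andP[mx ->].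
    by rewrite andbT (le_trans _ mx)// lef_pV2 ?posrE// ler_nat.
  - move=> n; apply/measurable_EFinP; apply: measurable_funX.
    by apply: measurable_funTS; exact: measurable_ln.
  - by move=> n x _; rewrite lee_fin sqr_ge0.
rewrite -(cvg_lim _ cv)//; apply: lime_le; first exact: cvgP cv.
by apply: nearW => n; exact: part.
Qed.


Let e (x : R) := expR (- x ^+ 2 / 2).

Lemma is_derive_gauss (x : R) : is_derive x 1 e (- x * e x).
Proof.
have dsq : is_derive x 1 (fun y : R => - y ^+ 2 / 2) (- x).
  by apply: is_derive_eq; rewrite /GRing.scale/=; field.
have := @is_derive1_comp R expR (fun y => - y ^+ 2 / 2) x _ _
  (is_derive_expR _) dsq.
by rewrite mulrC.
Qed.

Let continuous_e : continuous e.
Proof.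
move=> x; apply/differentiable_continuous/derivable1_diffP.
by have [] := is_derive_gauss x.
Qed.

(** Since [expR y >= 1 + y] at [y = x ^+ 2 / 2], the function is squeezed between 0 and [2 / x]. *)
Let cvg_xgauss : x * e x @[x --> +oo] --> (0 : R).
Proof.
have h (x : R) : 0 < x -> 0 <= x * e x <= 2 / x.
  move=> x0; rewrite mulr_ge0 ?expR_ge0 ?(ltW x0)//=.
  rewrite /e mulNr expRN ler_pdivlMr// mulrAC -expr2 ler_pdivrMr ?expR_gt0//.
  have := expR_ge1Dx (x ^+ 2 / 2); lra.
apply: (squeeze_cvgr (f := fun=> 0) (h := fun x => 2 / x)).
- near=> x; apply: h; near: x; exact: nbhs_pinfty_gt.
- exact: cvg_cst.
- rewrite -[X in _ --> X](mulr0 2); apply: cvgMr.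
  by apply/gtr0_cvgV0; [near=> x; near: x; exact: nbhs_pinfty_gt|exact: cvg_id].
Unshelve. all: end_near. Qed.

(** The difference of the integrands, [(1 - x ^+ 2) * e x], has antiderivative [x * e x], which
    vanishes at 0 and at infinity. Splitting at 1, where the sign changes, keeps every integrand
    nonnegative: one side gains [e 1] on [0, 1], the other gains it beyond 1. *)
Lemma integral_sqr_gauss :
  (\int[lambda]_(x in `[0%R, +oo[) (x ^+ 2 * e x)%:E =
   \int[lambda]_(x in `[0%R, +oo[) (e x)%:E)%E.
Proof.
have dxe (x : R) : is_derive x 1 (fun y => y * e y) ((1 - x ^+ 2) * e x).
  have de := is_derive_gauss x.
  by apply: is_derive_eq; rewrite /GRing.scale/=; ring.
have cxe : continuous (fun x : R => (1 - x ^+ 2) * e x).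
  move=> x; apply: cvgM; last exact: continuous_e.
  by apply: cvgB; [exact: cvg_cst|exact: exprn_continuous].
have I01 := integral_is_derive (@ltr01 R) (fun x _ => dxe x) (fun x _ => cxe x).
have I1y : (\int[lambda]_(x in `[1%R, +oo[) ((x ^+ 2 - 1) * e x)%:E = (e 1)%:E)%E.
  have dF (x : R) : is_derive x 1 (fun y => - (y * e y)) ((x ^+ 2 - 1) * e x).
    have dx := dxe x.
    by apply: is_derive_eq; ring.
  rewrite (@ge0_continuous_FTC2y _ _ (fun y => - (y * e y)) 1 0).
  - by rewrite -EFinB mul1r sub0r opprK.
  - by move=> x x1; rewrite mulr_ge0 ?expR_ge0// subr_ge0 exprn_ege1.
  - apply: continuous_subspaceT => x; apply: cvgM; last exact: continuous_e.
    by apply: cvgB; [exact: exprn_continuous|exact: cvg_cst].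
  - by rewrite -oppr0; exact: cvgN.
  - by move=> x _; have [] := dF x.
  - apply: cvg_at_right_filter; apply: cvgN; apply: cvgM; first exact: cvg_id.
    exact: continuous_e.
  - by move=> x _; rewrite derive1E; have [] := dF x.
have me : measurable_fun setT e by exact: continuous_measurable_fun.
have split01 (f : R -> R) : (forall x, 0 <= f x) -> measurable_fun setT f ->
    (\int[lambda]_(x in `[0%R, +oo[) (f x)%:E =
     \int[lambda]_(x in `[0%R, 1%R]) (f x)%:E +
     \int[lambda]_(x in `[1%R, +oo[) (f x)%:E)%E.
  move=> f0 mf; rewrite (@itv_bndbnd_setU _ _ (BLeft 0) (BLeft 1) +oo%O)//;
    last by rewrite bnd_simp.
  rewrite ge0_integral_setU//=.
  - congr (_ + _)%E; apply: integral_itv_bndo_bndc.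
    exact/measurable_EFinP/measurable_funTS.
  - exact/measurable_EFinP/measurable_funTS.
  - by move=> x _; rewrite lee_fin.
  - apply/disj_setPRL => x /=; rewrite !in_itv/= andbT => x1.
    by rewrite ltNge x1 andbF.
have e0 (x : R) : 0 <= e x by exact: expR_ge0.
have xe0 (x : R) : 0 <= x ^+ 2 * e x by rewrite mulr_ge0 ?sqr_ge0.
have mxe : measurable_fun setT (fun x : R => x ^+ 2 * e x).
  exact: measurable_funM.
rewrite (split01 _ xe0 mxe) (split01 _ e0 me).
have -> : (\int[lambda]_(x in `[0%R, 1%R]) (e x)%:E =
    \int[lambda]_(x in `[0%R, 1%R]) (x ^+ 2 * e x)%:E + (e 1)%:E)%E.
  have -> : e 1 = 1 * e 1 - 0 * e 0 by rewrite mul1r mul0r subr0.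
  rewrite -I01 -ge0_integralD//.
  - by apply: eq_integral => x _; rewrite -EFinD; congr EFin; ring.
  - by move=> x _; rewrite lee_fin.
  - by apply/measurable_EFinP; apply: measurable_funTS.
  - move=> x /=; rewrite in_itv/= => /andP[x0 x1].
    by rewrite lee_fin mulr_ge0 ?expR_ge0// subr_ge0 exprn_ile1.
  - apply/measurable_EFinP; apply: measurable_funTS.
    by apply: measurable_funM => //; apply: measurable_funB.
have -> : (\int[lambda]_(x in `[1%R, +oo[) (x ^+ 2 * e x)%:E =
    \int[lambda]_(x in `[1%R, +oo[) (e x)%:E + (e 1)%:E)%E.
  rewrite -I1y -ge0_integralD//.
  - by apply: eq_integral => x _; rewrite -EFinD; congr EFin; ring.
  - by move=> x _; rewrite lee_fin expR_ge0.
  - by apply/measurable_EFinP; apply: measurable_funTS.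
  - move=> x /=; rewrite in_itv/= andbT => x1.
    by rewrite lee_fin mulr_ge0 ?expR_ge0// subr_ge0 exprn_ege1.
  - apply/measurable_EFinP; apply: measurable_funTS.
    by apply: measurable_funM => //; apply: measurable_funB.
by rewrite -addeA; congr (_ + _)%E; exact: addeC.
Qed.

End calculus.

(** * Expectations under the standard normal law *)

Section normal_expectations.
Context {R : realType}.
Local Notation lambda := (@lebesgue_measure R).
Local Notation normal := (@normal_prob R).
Local Notation pos := `]0%R, +oo[%classic.
Let e (x : R) := expR (- x ^+ 2 / 2).
Let pk : R := normal_peak 1.

Let pk0 : 0 < pk. Proof. by rewrite normal_peak_gt0// oner_neq0. Qed.

Let e0 x : 0 <= e x. Proof. exact: expR_ge0. Qed.

Let normal_pdf01 x : normal_pdf 0 1 x = pk * e x.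
Proof.
rewrite normal_pdfE ?oner_neq0// /normal_fun subr0 /e; congr (_ * expR (_ / _)).
by ring.
Qed.

Lemma ge0_integral_even (f : R -> \bar R) : measurable_fun setT f ->
  (forall x, (0 <= f x)%E) -> (forall x, f (- x) = f x) ->
  (\int[lambda]_x f x = 2%:E * \int[lambda]_(x in pos) f x)%E.
Proof.
move=> mf f0 ef.
have mS (S : set (measurableTypeR R)) : measurable_fun S f.
  exact: measurable_funTS.
have U : `]-oo, 0%R] `|` pos = [set: R].
  apply/seteqP; split => // x _ /=; rewrite !in_itv/= andbT.
  by case: (leP x 0); [left|right].
rewrite -U ge0_integral_setU//; last first.
  apply/disj_setPRL => x /=; rewrite !in_itv/= andbT => x0.
  by apply/negP; rewrite -ltNge.
rewrite mule_natl mule2n; congr (_ + _)%E.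
rewrite integral_itv_obnd_cbnd; last exact: mS.
rewrite (ge0_integration_by_substitution0 mf f0).
by apply: eq_integral => x _; rewrite ef.
Qed.

Let me : measurable_fun setT e.
Proof.
apply: measurableT_comp => //; apply: measurable_funM => //.
by apply: measurableT_comp => //; exact: measurable_funX.
Qed.

(** Asking for [0 <= f t] only at [0 <= t] admits [f = id], which yields the second moment. *)
Lemma ge0_integral_normal_sqr (f : R -> R) : measurable_fun setT f ->
  (forall t, 0 <= t -> 0 <= f t) ->
  (\int[normal 0 1]_x (f (x ^+ 2))%:E =
   (2 * pk)%:E * \int[lambda]_(x in pos) (f (x ^+ 2) * e x)%:E)%E.
Proof.
move=> mf f0; have mfs : measurable_fun setT (fun x : R => f (x ^+ 2)).
  by apply: measurableT_comp => //; exact: measurable_funX.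
have fs0 x : 0 <= f (x ^+ 2) by rewrite f0// sqr_ge0.
rewrite (ge0_integral_normal_prob 0 1); last 2 first.
- exact/measurable_EFinP.
- by move=> x; rewrite lee_fin.
rewrite ge0_integral_even.
- rewrite EFinM -muleA; congr (_ * _)%E.
  rewrite -ge0_integralZl_EFin//; last 3 first.
  + by move=> x _; rewrite lee_fin mulr_ge0.
  + by apply/measurable_EFinP; apply: measurable_funTS; exact: measurable_funM.
  + exact: ltW.
  by apply: eq_integral => x _; rewrite -!EFinM normal_pdf01; congr EFin; ring.
- apply: emeasurable_funM; apply/measurable_EFinP => //.
  exact: measurable_normal_pdf.
- by move=> x; rewrite mule_ge0 ?lee_fin ?normal_pdf_ge0.
- by move=> x; rewrite !normal_pdf01 /e sqrrN.
Qed.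

(** [integral_sqr_gauss] reduces the second moment to the total mass, which is the case of the
    constant function 1; the Gaussian integral itself is never evaluated. *)
Lemma normal_second_moment : (\int[normal 0 1]_x (x ^+ 2)%:E = 1)%E.
Proof.
have cy (f : R -> R) : measurable_fun setT f -> (\int[lambda]_(x in pos) (f x)%:E =
    \int[lambda]_(x in `[0%R, +oo[) (f x)%:E)%E.
  move=> mf; apply: integral_itv_obnd_cbnd.
  exact/measurable_EFinP/measurable_funTS.
have -> := @ge0_integral_normal_sqr id (@measurable_id _ _ _) (fun t t0 => t0).
rewrite cy; last by apply: measurable_funM => //; exact: measurable_funX.
rewrite integral_sqr_gauss -cy//.
have := @ge0_integral_normal_sqr (cst 1) (@measurable_cst _ _ _ _ _ _)
  (fun t t0 => ler01).
under eq_integral do rewrite /=.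
rewrite integral_cst// [X in (_ * X)%E](normal_prob_setT 0 1) mule1.
by move=> ->; congr (_ * _)%E; apply: eq_integral => x _; rewrite /= mul1r.
Qed.

(* [pi > 2.7] is enough for the constant: [16 / sqrt (2 pi) <= 7]. *)
Lemma normal_ln_min_sqr :
  (\int[normal 0 1]_x (ln (Num.min (x ^+ 2) 1) ^+ 2)%:E <= 7%:E)%E.
Proof.
have mg : measurable_fun setT (fun t : R => ln (Num.min t 1) ^+ 2).
  apply: measurable_funX; apply: measurableT_comp; first exact: measurable_ln.
  exact: measurable_minr.
rewrite (ge0_integral_normal_sqr mg (fun t _ => sqr_ge0 _)).
have pk7 : 16 * pk <= 7.
  rewrite mulrC -ler_pdivlMr// /pk /normal_peak invf_ple ?posrE//; last first.
    by rewrite sqrtr_gt0 expr1n mul1r mulrn_wgt0// pi_gt0.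
  rewrite -(@ger0_norm _ (7 / 16)^-1)// -sqrtr_sqr ler_sqrt; last first.
    by rewrite expr1n mul1r mulrn_wge0// pi_ge0.
  have := @pi_gt27 R; rewrite expr1n mul1r; lra.
(* On ]0, 1] [ln (x ^+ 2)] is [2 * ln x], whence the 4 after squaring; the 2 is [integral_sqr_ln01].
   The factor [e] is at most 1, and beyond 1 the integrand is 0. *)
apply: (@le_trans _ _ ((2 * pk)%:E * (4 * 2)%:E)%E); last first.
  by rewrite -EFinM lee_fin; move: pk7; lra.
apply: lee_wpmul2l; first by rewrite lee_fin mulr_ge0// ltW.
have mln : measurable_fun setT (fun t : R => (ln t ^+ 2)%:E).
  by apply/measurable_EFinP; apply: measurable_funX; exact: measurable_ln.
apply: (@le_trans _ _ (\int[lambda]_(t in `]0%R, 1%R]) (4%:E * (ln t ^+ 2)%:E))%E).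
  have -> : `]0, 1]%classic = pos `&` `]0, 1]%classic :> set R.
    by apply/esym/setIidPr => x /=; rewrite !in_itv/= andbT => /andP[].
  rewrite integral_mkcondr; apply: ge0_le_integral => //.
  - by move=> x _; rewrite lee_fin mulr_ge0 ?sqr_ge0.
  - apply/measurable_EFinP; apply: measurable_funTS; apply: measurable_funM => //.
    by apply: measurableT_comp mg _; exact: measurable_funX.
  - apply: measurable_funTS; apply/(measurable_restrictT _ _).1 => //.
    by apply: measurable_funTS; exact: emeasurable_funM.
  - move=> x /=; rewrite in_itv/= andbT => x0; rewrite patchE.
    have [x1|x1] := leP x 1.
      rewrite mem_set/=; last by rewrite in_itv/= x0.
      rewrite min_l ?exprn_ile1 ?(ltW x0)// lnXn// -EFinM lee_fin.
      rewrite (_ : 4 * ln x ^+ 2 = (ln x *+ 2) ^+ 2); last by ring.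
      by rewrite ler_piMr ?sqr_ge0// expR_le1 mulNr oppr_le0 divr_ge0 ?sqr_ge0.
    rewrite memNset/=; last by rewrite in_itv/= leNgt x1 andbF.
    by rewrite min_r ?ln1 ?expr0n ?mul0r// exprn_ege1// (ltW x1).
rewrite ge0_integralZl_EFin//.
- by rewrite [leRHS]EFinM; apply: lee_wpmul2l => //; exact: integral_sqr_ln01.
- by move=> x _; rewrite lee_fin sqr_ge0.
- exact: measurable_funTS.
Qed.

(** Distributes a constant over positive and negative parts not yet known to be finite. *)
Let muleBr_gt0 (c : R) (x y : \bar R) : 0 < c -> (0 <= y)%E ->
  (c%:E * (x - y) = c%:E * x - c%:E * y)%E.
Proof.
move=> c0; case: y => [r _|_|//]; first by rewrite muleBr// fin_num_adde_defl.
by rewrite gt0_muley ?lte_fin// !addeNy gt0_muleNy ?lte_fin.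
Qed.

(** The integrand changes sign, so its positive and negative parts are treated apart, as the cases
    [s = 1] and [s = - 1] of [half]. The 4 in [C0] is 2 from evenness times 2 from
    [ln (x ^+ 2) = 2 * ln x]. *)
Lemma normal_ln_sqr : (\int[normal 0 1]_x (ln (x ^+ 2))%:E = C0 R)%E.
Proof.
pose h (x : R) := ln x * e x.
have mh : measurable_fun setT h by apply: measurable_funM => //; exact: measurable_ln.
have maxM (c y : R) : 0 <= c -> Num.max (y * c) 0 = Num.max y 0 * c.
  by move=> c0; rewrite maxr_pMl// mul0r.
have half (s : R) : (\int[normal 0 1]_x (Num.max (s * ln (x ^+ 2)) 0)%:E =
    (4 * pk)%:E * \int[lambda]_(x in pos) (Num.max (s * h x) 0)%:E)%E.
  have mmax (f : R -> R) : measurable_fun setT f ->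
      measurable_fun setT (fun x => Num.max (s * f x) 0).
    by move=> mf; apply: measurable_maxr => //; exact: measurable_funM.
  rewrite (@ge0_integral_normal_sqr (fun t => Num.max (s * ln t) 0)); last 2 first.
  - by apply: mmax; exact: measurable_ln.
  - by move=> t _; rewrite le_max lexx orbT.
  have -> : 4 * pk = (2 * pk) * 2 by ring.
  rewrite [in RHS]EFinM -muleA; congr (_ * _)%E.
  rewrite -ge0_integralZl_EFin//.
  - apply: eq_integral => x; rewrite inE/= in_itv/= andbT => x0.
    have -> : ln (x ^+ 2) = ln x * 2 by rewrite lnXn// mulr_natr.
    rewrite -EFinM mulrA (maxM 2)// /h mulrA (maxM (e x))//.
    by congr EFin; ring.
  - by move=> x _; rewrite lee_fin le_max lexx orbT.
  - by apply/measurable_EFinP; apply: measurable_funTS; exact: mmax.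
have k4 : 4 / Num.sqrt (2 * pi) = 4 * pk.
  by rewrite /pk /normal_peak expr1n mul1r (_ : 2 * pi = pi *+ 2)//; ring.
rewrite /C0 k4 [in LHS]integralE [in RHS]integralE muleBr_gt0.
- congr (_ - _)%E.
  + transitivity (\int[normal 0 1]_x (Num.max (1 * ln (x ^+ 2)) 0)%:E)%E.
      by apply: eq_integral => x _; rewrite funeposE -EFin_max mul1r.
    rewrite half; congr (_ * _)%E; apply: eq_integral => x _.
    by rewrite funeposE -EFin_max mul1r.
  + transitivity (\int[normal 0 1]_x (Num.max (- 1 * ln (x ^+ 2)) 0)%:E)%E.
      by apply: eq_integral => x _; rewrite funenegE -EFinN -EFin_max mulN1r.
    rewrite half; congr (_ * _)%E; apply: eq_integral => x _.
    by rewrite funenegE -EFinN -EFin_max mulN1r.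
- by rewrite mulr_gt0.
- by apply: integral_ge0 => x _; exact: funeneg_ge0.
Qed.

End normal_expectations.

(** * Inequalities for the logarithm *)

Section log_inequalities.
Context {R : realType}.
Implicit Types q w y : R.

(** This is [ln (1 + y) <= y] at [y = w / q - 1]; it is the tangent bound behind both Jensen
    inequalities below. *)
Lemma ln_sub_le q w : 0 < q -> 0 < w -> ln w - ln q <= w / q - 1.
Proof.
move=> q0 w0; rewrite -ln_div ?posrE//.
have := @le_ln1Dx R (w / q - 1); rewrite (addrC 1) subrK; apply.
by rewrite -subr_gt0 opprK subrK divr_gt0.
Qed.

(** With [y = sqrt q], the tangent at 2 and [ln 2 <= 1] give [ln y <= y / 2], so
    [ln q = 2 * ln y <= y]; then square. *)
Lemma sqr_ln_le q : 1 <= q -> ln q ^+ 2 <= q.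
Proof.
move=> q1; have q0 : 0 < q by rewrite (lt_le_trans _ q1).
have y0 : 0 < Num.sqrt q by rewrite sqrtr_gt0.
have qE : q = Num.sqrt q ^+ 2 by rewrite sqr_sqrtr// ltW.
have le2 := ln_sub_le (@ltr01 R) (@ltr0n R 2).
have := ln_sub_le (@ltr0n R 2) y0; rewrite ln1 in le2 => ley.
have lny : ln q = 2 * ln (Num.sqrt q).
  by rewrite [in LHS]qE lnXn// mulr_natl.
rewrite [leRHS]qE lerXn2r ?nnegrE ?ln_ge0// ?(ltW y0)// lny.
by move: ley le2; rewrite divr1; lra.
Qed.

Lemma sqr_ln_le_min q : 0 < q -> ln q ^+ 2 <= ln (Num.min q 1) ^+ 2 + q.
Proof.
move=> q0; have [q1|q1] := leP q 1; first by rewrite lerDl ltW.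
by rewrite ln1 expr0n/= add0r sqr_ln_le// ltW.
Qed.

(* [ln (min w 1) ^ 2] is a convex function of [w]: it lies above its tangents. *)
Lemma ln_min_sqr_tangent q w : 0 < q -> 0 < w ->
  ln (Num.min q 1) ^+ 2 + 2 * ln (Num.min q 1) * (w / q - 1) <= ln (Num.min w 1) ^+ 2.
Proof.
move=> q0 w0; have [q1|q1] := leP q 1; last first.
  by rewrite ln1 expr0n/= mulr0 mul0r addr0 sqr_ge0.
set A := ln q; set B := ln _.
have A0 : A <= 0 by exact: ln_le0.
have BA : B - A <= w / q - 1.
  apply: (@le_trans _ _ (ln w - ln q)); last exact: ln_sub_le.
  by rewrite lerD2r /B; case: (leP w 1) => [//|w1]; rewrite ln1 ln_ge0// ltW.
(* This yields [B ^+ 2 >= A ^+ 2 + 2 * A * (B - A)]; as [A <= 0], the upper bound on [B - A] becomes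
   a lower bound on the last term. *)
have := sqr_ge0 (B - A).
have : A * (w / q - 1) <= A * (B - A) by rewrite ler_wnM2l.
lra.
Qed.

Variables (m : nat) (l w : 'I_m -> R).
Hypotheses (l0 : forall k, 0 <= l k) (l1 : \sum_k l k = 1).
Hypothesis w0 : forall k, 0 < w k.
Let q := \sum_k l k * w k.

Lemma weighted_sum_gt0 : 0 < q.
Proof.
rewrite lt_neqAle eq_sym; apply/andP; split; last first.
  by apply: sumr_ge0 => k _; rewrite mulr_ge0// ltW.
apply/negP => /eqP q0; have := oner_neq0 R; rewrite -l1 big1 ?eqxx// => k _.
have lw : l k * w k = 0.
  apply: (psumr_eq0P _ q0) => // j _.
  by rewrite mulr_ge0// ltW.
by apply/eqP; move/eqP: lw; rewrite mulf_eq0 (gt_eqF (w0 k)) orbF.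
Qed.

(** [q] is the weighted mean of the [w k], so the first-order terms of the tangents at [q] cancel on
    averaging. *)
Let sum_dev : \sum_k l k * (w k / q - 1) = 0.
Proof.
under eq_bigr do rewrite mulrBr mulr1 mulrA.
by rewrite sumrB -mulr_suml l1 divff ?subrr// gt_eqF// weighted_sum_gt0.
Qed.

Let weighted_cst y : y = \sum_k l k * y.
Proof. by rewrite -mulr_suml l1 mul1r. Qed.

Lemma jensen_ln : \sum_k l k * ln (w k) <= ln q.
Proof.
have -> : ln q = \sum_k (l k * ln q + l k * (w k / q - 1)).
  by rewrite big_split/= sum_dev addr0 -weighted_cst.
apply: ler_sum => k _; rewrite -mulrDr ler_wpM2l//.
by have := ln_sub_le weighted_sum_gt0 (w0 k); lra.
Qed.

Lemma jensen_ln_min_sqr :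
  ln (Num.min q 1) ^+ 2 <= \sum_k l k * ln (Num.min (w k) 1) ^+ 2.
Proof.
have -> : ln (Num.min q 1) ^+ 2 = \sum_k (l k * ln (Num.min q 1) ^+ 2 +
    2 * ln (Num.min q 1) * (l k * (w k / q - 1))).
  by rewrite big_split/= -mulr_sumr sum_dev mulr0 addr0 -weighted_cst.
apply: ler_sum => k _; rewrite [X in _ + X]mulrCA -mulrDr ler_wpM2l//.
by rewrite ln_min_sqr_tangent// weighted_sum_gt0.
Qed.

End log_inequalities.

(** * Logarithmic moments *)

Section log_moments.
Context d {T : measurableType d} {R : realType}.
Variable mu : {measure set T -> \bar R}.
Hypothesis mu1 : mu setT = 1%E.

(** [ln 0] is 0 by convention, so bounds such as [ln w <= w - 1] fail where [w] vanishes; they are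
    compared only off that null set. *)
Lemma le_integral_off_null (D : set T) (f g : T -> \bar R) :
  measurable D -> mu (~` D) = 0%E ->
  mu.-integrable setT f -> mu.-integrable setT g ->
  (forall x, D x -> (f x <= g x)%E) ->
  (\int[mu]_x f x <= \int[mu]_x g x)%E.
Proof.
move=> mD muD fi gi fg; have mDc : measurable (~` D) by exact: measurableC.
rewrite (negligible_integral mDc measurableT fi muD).
rewrite (negligible_integral mDc measurableT gi muD) setTD setCK.
by apply: le_integral => //; [exact: integrableS fi|exact: integrableS gi|
  move=> x /set_mem; exact: fg].
Qed.

Variables (D : set T) (w : T -> R).
Hypotheses (mD : measurable D) (muD : mu (~` D) = 0%E).
Hypotheses (mw : measurable_fun setT w) (w0 : forall x, 0 <= w x).
Hypothesis wD : forall x, D x -> 0 < w x.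
Hypothesis Ew : (\int[mu]_x (w x)%:E = 1)%E.
Hypothesis Egw : (\int[mu]_x (ln (Num.min (w x) 1) ^+ 2)%:E <= 7%:E)%E.

Let mlnw : measurable_fun setT (fun x => ln (w x)).
Proof. by apply: measurableT_comp => //; exact: measurable_ln. Qed.

(** By [sqr_ln_le_min], with 8 = 7 + 1: 7 for the truncated logarithm, 1 for the mean of [w]. The
    function [w] is generic so as to cover both each square [w k] and the whole form. *)
Lemma integral_sqr_ln_le8 : (\int[mu]_x (ln (w x) ^+ 2)%:E <= 8%:E)%E.
Proof.
have mg : measurable_fun setT (fun x => ln (Num.min (w x) 1) ^+ 2).
  apply: measurable_funX; apply: measurableT_comp; first exact: measurable_ln.
  exact: measurable_minr.
apply: (@le_trans _ _ (\int[mu]_x ((ln (Num.min (w x) 1) ^+ 2)%:E + (w x)%:E))%E).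
  apply: ae_ge0_le_integral => //.
  - by move=> x _; rewrite lee_fin sqr_ge0.
  - by apply/measurable_EFinP; exact: measurable_funX.
  - by move=> x _; rewrite adde_ge0 ?lee_fin ?sqr_ge0.
  - by apply: emeasurable_funD; apply/measurable_EFinP.
  - exists (~` D); split => //; first exact: measurableC.
    move=> x /= H; apply: contra_not H => Dx _.
    by rewrite lee_fin sqr_ln_le_min// wD.
rewrite ge0_integralD//.
- by rewrite Ew (_ : 8 = 7 + 1 :> R)%R ?EFinD ?leeD2r//; ring.
- by move=> x _; rewrite lee_fin sqr_ge0.
- exact/measurable_EFinP.
- by move=> x _; rewrite lee_fin.
- exact/measurable_EFinP.
Qed.

(** Follows from the second moment through [|y| <= 1 + y ^+ 2]. *)
Lemma integrable_ln : mu.-integrable setT (fun x => (ln (w x))%:E).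
Proof.
apply/integrableP; split; first exact/measurable_EFinP.
apply: (@le_lt_trans _ _ (\int[mu]_x (1 + (ln (w x) ^+ 2)%:E))%E).
  apply: ge0_le_integral => //.
  - by apply/measurable_EFinP; exact: measurableT_comp.
  - by apply: emeasurable_funD => //; apply/measurable_EFinP; exact: measurable_funX.
  - move=> x _; rewrite /= -EFinD lee_fin -real_normK ?num_real//.
    by have := sqr_ge0 (`|ln (w x)| - 1); have := normr_ge0 (ln (w x)); nra.
rewrite ge0_integralD//; last 2 first.
- by move=> x _; rewrite lee_fin sqr_ge0.
- by apply/measurable_EFinP; exact: measurable_funX.
rewrite integral_cst// mul1e lte_add_pinfty//.
- by rewrite -ge0_fin_numE// mu1.
- exact: le_lt_trans integral_sqr_ln_le8 (ltry _).
Qed.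

Lemma integral_ln_le0 : (\int[mu]_x (ln (w x))%:E <= 0)%E.
Proof.
have iw : mu.-integrable setT (fun x => (w x)%:E).
  apply/integrableP; split; first exact/measurable_EFinP.
  rewrite (eq_integral (fun x => (w x)%:E)) ?Ew ?ltry// => x _.
  by rewrite /= ger0_norm.
have i1 : mu.-integrable setT (cst 1%E).
  apply/integrableP; split => //.
  under eq_integral do rewrite /= normr1.
  by rewrite integral_cst// mul1e mu1 ltry.
have <- : (\int[mu]_x ((w x)%:E - 1) = 0)%E.
  by rewrite integralB// Ew integral_cst// mul1e [X in (_ - X)%E]mu1 subee.
apply: (le_integral_off_null mD muD integrable_ln).
  exact: (integrableB measurableT iw i1).
move=> x Dx; rewrite -EFinB lee_fin.
by have := ln_sub_le (@ltr01 R) (wD Dx); rewrite ln1 subr0 divr1.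
Qed.

End log_moments.

(** * Unit linear forms *)

Section unit_linear_form.
Context {R : realType} {n : nat}.
Variables (mu : {measure set (n.-tuple R) -> \bar R}) (u : 'I_n -> R).
Hypotheses (mu_gauss : is_std_gaussian mu) (u1 : \sum_i u i ^+ 2 = 1).

Let form (x : n.-tuple R) : R := \sum_i u i * tnth x i.

Let mform : measurable_fun setT form.
Proof. exact: measurable_linear_form. Qed.

Lemma unit_linear_form_law (B : set R) : measurable B ->
  mu (form @^-1` B) = normal_prob 0 1 B.
Proof.
move=> mB; rewrite (std_gaussian_linear_form mu_gauss (t := 1))//; last first.
  by rewrite expr1n.
congr (normal_prob 0 1 _); apply/seteqP.
by split => x /=; rewrite mul1r addr0.
Qed.

Lemma ge0_integral_unit_linear_form (f : R -> \bar R) :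
  measurable_fun setT f -> (forall y, (0 <= f y)%E) ->
  (\int[mu]_x f (form x) = \int[normal_prob 0 1]_y f y)%E.
Proof.
move=> mf f0.
have mform' : @measurable_fun _ _ _ (measurableTypeR R) setT form by exact: mform.
transitivity (\int[pushforward mu (form : _ -> measurableTypeR R)]_y f y)%E.
  by rewrite (ge0_integral_pushforward mform' mu).
apply: eq_measure_integral => B mB _.
exact: unit_linear_form_law.
Qed.

Lemma integral_unit_linear_form (f : R -> \bar R) : measurable_fun setT f ->
  (\int[mu]_x f (form x) = \int[normal_prob 0 1]_y f y)%E.
Proof.
move=> mf; rewrite [LHS]integralE [RHS]integralE.
rewrite -(ge0_integral_unit_linear_form (measurable_funepos mf)); last first.
  by move=> y; exact: funepos_ge0.
rewrite -(ge0_integral_unit_linear_form (measurable_funeneg mf))//.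
by congr (_ - _)%E; apply: eq_integral => x _; rewrite ?funeposE ?funenegE.
Qed.

End unit_linear_form.

(** * Logarithmic moments of the form, from those of the squares composing it *)

Theorem theorem3p3 (R : realType) (n : nat)
    (mu : {measure set (n.-tuple R) -> \bar R})
    (a : 'M[R]_n) :
  is_std_gaussian mu ->
  (forall x, 0 <= quadform a x) ->
  (\int[mu]_x (quadform a x)%:E = 1)%E ->
  (C0 R <= \int[mu]_x (ln (quadform a x))%:E <= 0)%E /\
  (0 <= \int[mu]_x ((ln (quadform a x)) ^+ 2)%:E <= 8%:E)%E.
Proof.
move=> mu_gauss q0 Eq.
have mu1 := std_gaussian_setT mu_gauss.
have [|m [l [u [l0 u1 qE]]]] := @psd_sum_of_squares R n a.
  move=> x; have := q0 [tuple x 0 i | i < n]; rewrite /quadform.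
  by under eq_bigr do under eq_bigr do rewrite !tnth_mktuple.
pose S k (x : n.-tuple R) := \sum_i u k i * tnth x i.
pose w k x := S k x ^+ 2.
have {}qE x : quadform a x = \sum_k l k * w k x by exact: qE.
have mS k : measurable_fun setT (S k) by exact: measurable_linear_form.
have mw k : measurable_fun setT (w k) by exact: measurable_funX.
have w0 k x : 0 <= w k x by exact: sqr_ge0.
have Ew k : (\int[mu]_x (w k x)%:E = 1)%E.
  rewrite -[RHS](@normal_second_moment R).
  apply: (ge0_integral_unit_linear_form mu_gauss (u1 k) (f := fun y => (y ^+ 2)%:E)).
    by apply/measurable_EFinP; exact: measurable_funX.
  by move=> y; rewrite lee_fin sqr_ge0.
have mlm : measurable_fun setT (fun t : R => ln (Num.min t 1) ^+ 2).
  apply: measurable_funX; apply: measurableT_comp; first exact: measurable_ln.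
  exact: measurable_minr.
have Egw k : (\int[mu]_x (ln (Num.min (w k x) 1) ^+ 2)%:E <= 7%:E)%E.
  apply: le_trans (@normal_ln_min_sqr R).
  rewrite (ge0_integral_unit_linear_form mu_gauss (u1 k)
    (f := fun y => (ln (Num.min (y ^+ 2) 1) ^+ 2)%:E))//.
    by apply/measurable_EFinP; apply: measurableT_comp mlm _; exact: measurable_funX.
  by move=> y; rewrite lee_fin sqr_ge0.
have Elnw k : (\int[mu]_x (ln (w k x))%:E = C0 R)%E.
  rewrite -normal_ln_sqr.
  apply: (integral_unit_linear_form mu_gauss (u1 k) (f := fun y => (ln (y ^+ 2))%:E)).
  apply/measurable_EFinP; apply: measurableT_comp; first exact: measurable_ln.
  exact: measurable_funX.
have lw0 k x : 0 <= l k * w k x by rewrite mulr_ge0.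
have l1 : \sum_k l k = 1.
  apply: EFin_inj; rewrite -Eq.
  under [RHS]eq_integral do rewrite qE -sumEFin.
  rewrite ge0_integral_sum//; last 2 first.
  - by move=> k; apply/measurable_EFinP; exact: measurable_funM.
  - by move=> k x _; rewrite lee_fin.
  rewrite -sumEFin; apply: eq_bigr => k _.
  under eq_integral do rewrite EFinM.
  rewrite ge0_integralZl_EFin ?Ew ?mule1//.
  - by move=> x _; rewrite lee_fin.
  - exact/measurable_EFinP.
(* The complement is a finite union of hyperplanes [S k x = 0], each null because N(0, 1) has no
   atom at 0. On [D] every logarithm has a positive argument. *)
pose D := [set x | forall k, 0 < w k x].
have DE : D = \bigcap_(k in [set: 'I_m]) (S k @^-1` (~` [set 0])).
  apply/seteqP; split => x /=.
    by move=> Dx k _ /= Sk; have := Dx k; rewrite /w Sk expr0n/= ltxx.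
  move=> Sx k; rewrite lt_neqAle sqr_ge0 andbT eq_sym sqrf_eq0.
  by apply/eqP => /(Sx k I).
have mD : measurable D.
  rewrite DE; apply: fin_bigcap_measurable => // k _.
  by rewrite -[X in measurable X]setTI; apply: mS => //; exact: measurableC.
have muD : mu (~` D) = 0%E.
  have Sk0 k : mu (S k @^-1` [set 0]) = 0%E.
    rewrite (unit_linear_form_law mu_gauss (u1 k)) ?measurable_set1//.
    exact: integral_set1.
  have : {ae mu, forall x, forall k, 0 < w k x}.
    apply: filter_forall => k; exists (S k @^-1` [set 0]); split => //.
      by rewrite -[X in measurable X]setTI; exact: mS.
    move=> x /= /negP; rewrite -leNgt => wx; apply/eqP.
    by rewrite -sqrf_eq0 eq_le wx w0.
  move=> ae; apply/negligibleP; first exact: measurableC.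
  exact: ae.
have wD k x : D x -> 0 < w k x by exact.
have qD x : D x -> 0 < quadform a x.
  by move=> Dx; rewrite qE; apply: weighted_sum_gt0 => // k; exact: Dx.
have mq : measurable_fun setT (quadform a).
  rewrite (funext qE).
  by apply: measurable_sum => k; exact: measurable_funM.
have Egq : (\int[mu]_x (ln (Num.min (quadform a x) 1) ^+ 2)%:E <= 7%:E)%E.
  have mgw k : measurable_fun setT (fun x => ln (Num.min (w k x) 1) ^+ 2).
    exact: measurableT_comp mlm _.
  apply: (@le_trans _ _ (\int[mu]_x \sum_k (l k * ln (Num.min (w k x) 1) ^+ 2)%:E)%E).
    apply: ae_ge0_le_integral => //.
    - by move=> x _; rewrite lee_fin sqr_ge0.
    - by apply/measurable_EFinP; exact: measurableT_comp mlm _.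
    - by move=> x _; apply: sume_ge0 => k _; rewrite lee_fin mulr_ge0// sqr_ge0.
    - by apply: emeasurable_sum => k; apply/measurable_EFinP; exact: measurable_funM.
    exists (~` D); split => //; first exact: measurableC.
    move=> x /= H; apply: contra_not H => Dx _.
    by rewrite sumEFin lee_fin qE jensen_ln_min_sqr// => k; exact: Dx.
  rewrite ge0_integral_sum//; last 2 first.
  - by move=> k; apply/measurable_EFinP; exact: measurable_funM.
  - by move=> k x _; rewrite lee_fin mulr_ge0// sqr_ge0.
  have -> : 7%:E = (\sum_k (l k)%:E * 7%:E)%E.
    by rewrite -ge0_sume_distrl ?sumEFin ?l1 ?mul1e// => k _; rewrite lee_fin.
  apply: lee_sum => k _; under eq_integral do rewrite EFinM.
  rewrite ge0_integralZl_EFin//.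
  - by apply: lee_wpmul2l; rewrite ?lee_fin.
  - by move=> x _; rewrite lee_fin sqr_ge0.
  - exact/measurable_EFinP.
split; last first.
  rewrite (integral_sqr_ln_le8 mD muD mq q0 qD Eq Egq) andbT.
  by apply: integral_ge0 => x _; rewrite lee_fin sqr_ge0.
rewrite (integral_ln_le0 mu1 mD muD mq q0 qD Eq Egq) andbT.
have ilnw k : mu.-integrable setT (fun x => (ln (w k x))%:E).
  exact: (integrable_ln mu1 mD muD (mw k) (w0 k) (wD k) (Ew k) (Egw k)).
have illnw k : mu.-integrable setT (fun x => (l k)%:E * (ln (w k x))%:E)%E.
  exact: integrableZl.
(* Every [ln (w k x)] has expectation [C0] and the weights sum to 1, so [C0] is the expectation of
   the lower bound supplied by [jensen_ln]. *)
have -> : (C0 R = \int[mu]_x \sum_k ((l k)%:E * (ln (w k x))%:E))%E.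
  rewrite integral_sum//.
  under eq_bigr do rewrite integralZl// Elnw.
  by rewrite -ge0_sume_distrl ?sumEFin ?l1 ?mul1e// => k _; rewrite lee_fin.
apply: (le_integral_off_null mD muD).
- exact: integrable_sum.
- exact: (integrable_ln mu1 mD muD mq q0 qD Eq Egq).
move=> x Dx; under eq_bigr do rewrite -EFinM.
by rewrite sumEFin lee_fin qE jensen_ln// => k; exact: Dx.
Qed.
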